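(* Let $\|\cdot\|$ be an arbitrary norm on $\mathbb{R}^n$ with dual norm $\|\cdot\|_*$, let $P_0 \in \mathcal{M}(\mathbb{R}^n)$ be a nominal distribution, let $r \ge 0$, and let $\mathcal{P} = \{P \in \mathcal{M}(\mathbb{R}^n) \mid W_1(P, P_0) \le r\}$. Assume that the feasible set $\mathcal{X} \subset \mathbb{R}^n$ is nonempty and compact. Then for every $x \in \mathcal{X}$, $$\sup_{P \in \mathcal{P}} \mathbb{E}_P[R(x, \boldsymbol{w})] \;=\; \mathbb{E}_{P_0}[R(x, \boldsymbol{w})] \;+\; r \sup_{v \in \mathcal{X}} \|x - v\|_* .$$ Furthermore, a point $x \in \mathcal{X}$ is an optimal solution to the problem $$\inf_{x \in \mathcal{X}} \; \sup_{P \in \mathcal{P}} \mathbb{E}_P[R(x, \boldsymbol{w})]$$ if and only if it is an optimal solution to the problem $$\inf_{x \in \mathcal{X}} \Big\{ \mathbb{E}_{P_0}[\boldsymbol{w}^\top x] + r \sup_{v \in \mathcal{X}} \|x - v\|_* \Big\}.$$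
   Context: The dual norm is $\|x\|_* := \sup\{x^\top y \mid \|y\| \le 1\}$ for $x \in \mathbb{R}^n$. $\mathcal{M}(\mathbb{R}^n)$ denotes the collection of Borel probability measures $P$ on $\mathbb{R}^n$ with $\mathbb{E}_P[\|\boldsymbol{w}\|] < \infty$, where $\boldsymbol{w}$ denotes a random vector in $\mathbb{R}^n$ with distribution $P$ under $\mathbb{E}_P$. The type-1 Wasserstein distance between $P_1, P_2 \in \mathcal{M}(\mathbb{R}^n)$ is $$W_1(P_1, P_2) := \inf_{\pi \in \Pi(P_1, P_2)} \int_{\mathbb{R}^n \times \mathbb{R}^n} \|z_1 - z_2\| \, \pi(dz_1, dz_2),$$ where $\Pi(P_1,P_2)$ is the set of all joint distributions in $\mathcal{M}(\mathbb{R}^n \times \mathbb{R}^n)$ with marginals $P_1$ and $P_2$. The (ex post) regret of a decision $x \in \mathcal{X}$ given a realization $w \in \mathbb{R}^n$ is $R(x, w) := w^\top x - \inf_{y \in \mathcal{X}} w^\top y$. *)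

(* Defs.v *)
From HB Require Import structures.
From mathcomp Require Import all_boot all_order all_algebra.
From mathcomp Require Import all_classical all_reals all_analysis.

Set Implicit Arguments.
Unset Strict Implicit.
Unset Printing Implicit Defensive.

Import Order.TTheory GRing.Theory Num.Theory.
Import numFieldNormedType.Exports.

Local Open Scope classical_set_scope.
Local Open Scope ring_scope.
Local Open Scope ereal_scope.

(* The join of the library's product topology and pointed product, so that the
   Borel sigma-algebra of R^n * R^n can be formed. *)
HB.instance Definition _ (T U : ptopologicalType) := Pointed.on (T * U)%type.

(* Elements of R^n are row vectors, so x^T y is written x *m y^T here. *)
Definition dot (R : realType) (n : nat) (x y : 'rV[R]_n) : R :=
  (x *m y^T)%R ord0 ord0.

(* An arbitrary norm has to be a function: the canonical norm `|x| of 'rV[R]_n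
   is the max norm. *)
Record is_norm (R : realType) (n : nat) (N : 'rV[R]_n -> R) : Prop := IsNorm {
  is_normD : forall x y, (N (x + y) <= N x + N y)%R;
  is_normZ : forall (a : R) x, N (a *: x)%R = (`|a| * N x)%R;
  is_norm_eq0 : forall x, N x = 0%R -> x = 0%R }.

(* The real-valued sup and inf below are junk on unbounded sets; dual_norm is
   always over a bounded set when N is a norm, and regret and max_dual_dist are
   when X is compact and nonempty. *)
Definition dual_norm (R : realType) (n : nat) (N : 'rV[R]_n -> R)
    (x : 'rV[R]_n) : R :=
  sup [set dot x y | y in [set y | (N y <= 1)%R]].

Definition borel (T : ptopologicalType) := g_sigma_algebraType (@open T).

Definition finite_moment (R : realType) (T : ptopologicalType) (N : T -> R)
    (P : probability (borel T) R) : Prop :=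
  'E_P[N] < +oo.

(* A norm on R^n * R^n; since all norms there are equivalent, which one is used
   in finite_moment is irrelevant. *)
Definition pair_norm (R : realType) (n : nat) (N : 'rV[R]_n -> R)
    (z : 'rV[R]_n * 'rV[R]_n) : R := (N z.1 + N z.2)%R.

(* The marginal conditions are restricted to measurable sets because the value
   of a {measure set _ -> _} on other sets is unspecified. *)
Definition coupling (R : realType) (n : nat) (N : 'rV[R]_n -> R)
    (P1 P2 : probability (borel 'rV[R]_n) R) :
    set (probability (borel ('rV[R]_n * 'rV[R]_n)%type) R) :=
  [set pi | [/\ finite_moment (pair_norm N) pi,
     forall A : set (borel 'rV[R]_n), measurable A ->
       pi (fst @^-1` A) = P1 A &
     forall A : set (borel 'rV[R]_n), measurable A ->
       pi (snd @^-1` A) = P2 A]].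

Definition W1 (R : realType) (n : nat) (N : 'rV[R]_n -> R)
    (P1 P2 : probability (borel 'rV[R]_n) R) : \bar R :=
  ereal_inf [set \int[pi]_z (N (z.1 - z.2)%R)%:E | pi in coupling N P1 P2].

Definition wasserstein_ball (R : realType) (n : nat) (N : 'rV[R]_n -> R)
    (P0 : probability (borel 'rV[R]_n) R) (r : R) :
    set (probability (borel 'rV[R]_n) R) :=
  [set P | finite_moment N P /\ W1 N P P0 <= r%:E].

Definition regret (R : realType) (n : nat) (X : set 'rV[R]_n)
    (x w : 'rV[R]_n) : R :=
  (dot w x - inf [set dot w y | y in X])%R.

Definition worst_case_regret (R : realType) (n : nat) (N : 'rV[R]_n -> R)
    (P0 : probability (borel 'rV[R]_n) R) (r : R) (X : set 'rV[R]_n)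
    (x : 'rV[R]_n) : \bar R :=
  ereal_sup ((fun P : probability (borel 'rV[R]_n) R => 'E_P[regret X x])
             @` wasserstein_ball N P0 r).

Definition max_dual_dist (R : realType) (n : nat) (N : 'rV[R]_n -> R)
    (X : set 'rV[R]_n) (x : 'rV[R]_n) : R :=
  sup [set dual_norm N (x - v)%R | v in X].

Definition optimal_solution (R : realType) (T : Type) (X : set T)
    (f : T -> \bar R) (x : T) : Prop :=
  X x /\ forall y, X y -> f x <= f y.

(* Main.v *)
From HB Require Import structures.
Require Import Defs.
From mathcomp Require Import all_boot all_order all_algebra.
From mathcomp Require Import all_classical all_reals all_analysis.
From mathcomp Require Import measurable_realfun ring lra.

Set Implicit Arguments.
Unset Strict Implicit.
Unset Printing Implicit Defensive.

Import Order.TTheory GRing.Theory Num.Theory.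
Import numFieldNormedType.Exports.

Local Open Scope classical_set_scope.
Local Open Scope ring_scope.
Local Open Scope ereal_scope.

(** The regret R(x, w) is the maximum over v in X of the linear functions
    w |-> w^T (x - v), so as a function of w it is Lipschitz for N with constant
    L = max_v ||x - v||_*, by Hoelder's inequality for the dual norm. This
    one constant governs both inequalities of the duality formula.

    Upper bound. If pi couples P and P0, integrating
    R(x, z1) <= R(x, z2) + L N(z1 - z2) over pi compares the two expected
    regrets up to L times the cost of pi, and the cost can be taken arbitrarily
    close to r ([expectation_regret_le]).

    Lower bound. A translate of P0 does not attain the bound in general, since
    the regret grows at rate L only far away, in the right direction. So a small
    mass e is moved very far: with probability 1 - e nothing happens, with
    probability e the outcome w is translated by (r/e) u, where N u <= 1. The
    cost is r N u <= r. On the mass that moves, the regret is at least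
    (w + (r/e) u)^T (x - v) >= (r/e) u^T (x - v) - L N(w), so the expected
    regret gains r u^T (x - v) up to an error of order e
    ([expectation_regret_ge]). Letting e tend to 0 and taking suprema over u
    and v gives r L ([worst_case_regretE]). Since the regret is nonnegative on
    X, all these estimates are between nonnegative integrals.

    Optimal solutions. R(x, w) - w^T x does not depend on x, and both terms
    are integrable, so the two objectives differ by a finite constant on X. *)

(** * The dot product *)

Section dot_product.
Context (R : realType) (n : nat).
Implicit Types (w x y : 'rV[R]_n) (a : R).
Local Open Scope ring_scope.

Lemma dotE x y : dot x y = \sum_i x ord0 i * y ord0 i.
Proof. by rewrite /dot mxE; apply: eq_bigr => i _; rewrite mxE. Qed.

Lemma dotC x y : dot x y = dot y x.
Proof. by rewrite !dotE; apply: eq_bigr => i _; rewrite mulrC. Qed.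

Lemma dotDl x y w : dot (x + y) w = dot x w + dot y w.
Proof. by rewrite /dot mulmxDl mxE. Qed.

Lemma dotZl a x w : dot (a *: x) w = a * dot x w.
Proof. by rewrite /dot -scalemxAl mxE. Qed.

Lemma dotBl x y w : dot (x - y) w = dot x w - dot y w.
Proof. by rewrite -scaleN1r dotDl dotZl mulN1r. Qed.

Lemma dotBr x y w : dot w (x - y) = dot w x - dot w y.
Proof. by rewrite ![dot w _]dotC dotBl. Qed.

Lemma coord_le_mx_norm x i : `|x ord0 i| <= `|x|.
Proof.
have /mapP[j Hj ->] : `|x ord0 i| \in [seq `|x k.1 k.2| | k : 'I_1 * 'I_n].
  by apply/mapP; exists (ord0, i) => //=; rewrite mem_enum.
rewrite [leRHS]/Num.norm /= mx_normrE.
by apply/bigmax_geP; right => /=; exists j.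
Qed.

Lemma normr_dot_le x y : `|dot x y| <= n%:R * `|x| * `|y|.
Proof.
rewrite dotE (le_trans (ler_norm_sum _ _ _))//.
rewrite (@le_trans _ _ (\sum_(i < n) (`|x| * `|y|)))//.
  apply: ler_sum => i _; rewrite normrM.
  by apply: ler_pM => //; exact: coord_le_mx_norm.
by rewrite sumr_const card_ord -mulrA mulr_natl.
Qed.

End dot_product.

(** * Norms on R^n and their duals *)

Section norm_on_Rn.
Context (R : realType) (n : nat) (N : 'rV[R]_n -> R) (hN : is_norm N).
Implicit Types (w x y z : 'rV[R]_n) (a : R).
Local Open Scope ring_scope.

Lemma is_norm0 : N 0 = 0.
Proof. by rewrite -(scale0r 0) (is_normZ hN) normr0 mul0r. Qed.

Lemma is_normN x : N (- x) = N x.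
Proof. by rewrite -scaleN1r (is_normZ hN) normrN normr1 mul1r. Qed.

Lemma is_norm_ge0 x : 0 <= N x.
Proof.
have := is_normD hN x (- x).
by rewrite subrr is_norm0 is_normN -mulr2n pmulrn_lge0.
Qed.

Lemma is_norm_le_mx_norm : exists2 C, 0 <= C & forall x, N x <= C * `|x|.
Proof.
exists (\sum_(i < n) N (delta_mx 0 i)).
  by apply: sumr_ge0 => i _; exact: is_norm_ge0.
move=> x; rewrite {1}(row_sum_delta x) mulr_suml.
have -> : \sum_(i < n) N (delta_mx 0 i) * `|x| =
    \sum_(i < n) `|x| * N (delta_mx 0 i).
  by apply: eq_bigr => i _; rewrite mulrC.
elim/big_ind2 : _ => [|? ? ? ? h1 h2|i _]; first by rewrite is_norm0.
  by rewrite (le_trans (is_normD hN _ _)) ?lerD.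
rewrite (is_normZ hN) ler_wpM2r ?is_norm_ge0//; exact: coord_le_mx_norm.
Qed.

(** Gives the continuity of N, of dot products and of regrets. A one-sided
    Lipschitz bound suffices because x and y can be exchanged, and N is
    dominated by the max norm, which defines the topology. *)
Lemma lipschitz_is_continuous (f : 'rV[R]_n -> R) (L : R) : 0 <= L ->
  (forall x y, f x <= f y + L * N (x - y)) -> continuous f.
Proof.
move=> L0 fL x.
have [C C0 NC] := is_norm_le_mx_norm.
(* L * C + 1 rather than L * C, as the latter may vanish. *)
apply/(@cvgrPdist_le _ R^o _ _ (nbhs_filter x)) => e e0.
have d0 : 0 < e / (L * C + 1) by rewrite divr_gt0// ltr_wpDl// mulr_ge0.
have : \forall y \near x, `|x - y| <= e / (L * C + 1).
  exact: (@cvgr_dist_le _ _ _ _ (nbhs_filter x) id).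
apply: (@filterS _ _ (nbhs_filter x)) => y xy.
have : L * N (x - y) <= e.
  rewrite (@le_trans _ _ ((L * C + 1) * `|x - y|))//.
    rewrite mulrDl mul1r -mulrA (@le_trans _ _ (L * (C * `|x - y|)))//.
      by rewrite ler_wpM2l.
    by rewrite lerDl.
  by rewrite mulrC -ler_pdivlMr// ltr_wpDl// mulr_ge0.
have := fL x y; have := fL y x.
rewrite -(is_normN (y - x)) opprB ler_norml; lra.
Qed.

Lemma is_norm_continuous : continuous N.
Proof.
apply: (@lipschitz_is_continuous N 1) => // x y.
by rewrite mul1r (le_trans _ (is_normD hN _ _))// [y + _]addrC subrK.
Qed.

(** The half of the equivalence of norms that needs compactness: the continuous
    function N attains a positive minimum on the unit sphere of the max norm. *)
Lemma mx_norm_le_is_norm : exists2 C, 0 <= C & forall x, `|x| <= C * N x.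
Proof.
pose S := [set x : 'rV[R]_n | `|x| = 1].
(* The sphere is empty when n = 0. *)
have [S0|S0] := pselect (S !=set0); last first.
  exists 0 => // x; rewrite mul0r leNgt; apply/negP => x0; apply: S0.
  exists (`|x|^-1 *: x); rewrite /S/= normrZ normfV normr_id mulVf//.
  by rewrite gt_eqF.
have S_compact : compact S.
  apply: bounded_closed_compact.
    by exists 1; split => // M M1 x; rewrite /S/= => ->; exact: ltW.
  apply: (@preimage_closed _ _ (fun x : 'rV[R]_n => `|x|) [set 1]).
    by move=> x _; exact: norm_continuous.
  exact: closed_eq.
have [|c cS cmin] := EVT_min_rV S0 S_compact (f := N).
  by apply: continuous_subspaceT; exact: is_norm_continuous.
have Nc0 : 0 < N c.
  rewrite lt_neqAle is_norm_ge0 andbT eq_sym; apply/eqP => /(is_norm_eq0 hN) c0.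
  by move: cS; rewrite inE /S/= c0 normr0 => /esym/eqP; rewrite oner_eq0.
exists (N c)^-1; first by rewrite invr_ge0 ltW.
move=> x; have [->|x0] := eqVneq x 0; first by rewrite normr0 is_norm0 mulr0.
have : N c <= N (`|x|^-1 *: x).
  by apply: cmin; rewrite inE /S/= normrZ normfV normr_id mulVf// normr_eq0.
rewrite (is_normZ hN) normfV normr_id ler_pdivlMl ?normr_gt0//.
by rewrite mulrC -ler_pdivlMl.
Qed.

Lemma normr_dot_le_is_norm :
  exists2 K, 0 <= K & forall w x, `|dot w x| <= K * N w * `|x|.
Proof.
have [C C0 NC] := mx_norm_le_is_norm.
exists (n%:R * C); first by rewrite mulr_ge0.
move=> w x; rewrite (le_trans (normr_dot_le _ _))// ler_wpM2r// -mulrA.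
by rewrite ler_wpM2l.
Qed.

Lemma dual_ball_bounded : exists2 K, 0 <= K &
  forall x, ubound [set dot x y | y in [set y | N y <= 1]] (K * `|x|).
Proof.
have [K K0 NK] := normr_dot_le_is_norm; exists K => // x _ [y /= Ny <-].
rewrite dotC (le_trans (ler_norm _))// (le_trans (NK _ _))// ler_wpM2r//.
by rewrite ler_piMr.
Qed.

Lemma has_sup_dual_norm x : has_sup [set dot x y | y in [set y | N y <= 1]].
Proof.
split; first by exists (dot x 0), 0; rewrite //= is_norm0.
by have [K _ xK] := dual_ball_bounded; exists (K * `|x|).
Qed.

Lemma dual_norm_le : exists2 K, 0 <= K & forall x, dual_norm N x <= K * `|x|.
Proof.
have [K K0 xK] := dual_ball_bounded; exists K => // x.
exact: ge_sup (has_sup_dual_norm x).1 (xK x).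
Qed.

Lemma dual_norm_ge0 x : 0 <= dual_norm N x.
Proof.
apply: ub_le_sup; first exact: (has_sup_dual_norm x).2.
by exists 0; rewrite /= ?is_norm0// /dot trmx0 mulmx0 mxE.
Qed.

(** Hoelder's inequality, by homogeneity from the definition of the dual
    norm. *)
Lemma dot_le_dual_norm w x : dot w x <= N w * dual_norm N x.
Proof.
have [w0|w0] := eqVneq (N w) 0.
  by rewrite (is_norm_eq0 hN w0) is_norm0 mul0r /dot mul0mx mxE.
have Nw : 0 < N w by rewrite lt_neqAle eq_sym w0 is_norm_ge0.
rewrite mulrC -ler_pdivrMr// mulrC -dotZl dotC.
apply: ub_le_sup; first exact: (has_sup_dual_norm x).2.
exists ((N w)^-1 *: w) => //=.
by rewrite (is_normZ hN) normfV ger0_norm ?is_norm_ge0// mulVf.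
Qed.

End norm_on_Rn.

(** * The regret of a fixed outcome *)

Section regret.
Context (R : realType) (n : nat) (N : 'rV[R]_n -> R) (X : set 'rV[R]_n).
Context (hN : is_norm N) (X_compact : compact X).
Implicit Types (u v w x y : 'rV[R]_n) (a s : R).
Local Open Scope ring_scope.

Let D x := max_dual_dist N X x.

Lemma dual_norm_le_max_dual_dist x v : X v -> dual_norm N (x - v) <= D x.
Proof.
move=> Xv; apply: ub_le_sup; last by exists v.
have [K K0 NK] := dual_norm_le hN.
have [M [_ /(_ (M + 1))]] := compact_bounded X_compact.
rewrite ltrDl ltr01 => /(_ isT) XM.
exists (K * (`|x| + (M + 1))) => _ [y Xy <-].
rewrite (le_trans (NK _))// ler_wpM2l// (le_trans (ler_normB _ _))// lerD2l.
exact: XM.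
Qed.

Lemma max_dual_dist_ge0 x : X x -> 0 <= D x.
Proof.
move=> /(dual_norm_le_max_dual_dist x).
exact: le_trans (dual_norm_ge0 hN _).
Qed.

Lemma dot_le_max_dual_dist x v w : X v -> dot w (x - v) <= D x * N w.
Proof.
move=> Xv; rewrite (le_trans (dot_le_dual_norm hN _ _))// mulrC.
by rewrite ler_wpM2r ?is_norm_ge0//; exact: dual_norm_le_max_dual_dist.
Qed.

(** Unfolds both suprema in the maximal dual distance at once. The point x
    itself makes the suprema nonempty, and when r = 0 it supplies the pair 0, x
    that shows a to be nonnegative. *)
Lemma mul_max_dual_dist_le r x a : 0 <= r -> X x ->
    (forall u v, N u <= 1 -> X v -> r * dot u (x - v) <= a) ->
  r * D x <= a.
Proof.
move=> r0 Xx ra; move: r0; rewrite le_eqVlt => /predU1P[r0|r0].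
  have := ra 0 x _ Xx; rewrite -r0 !mul0r; apply.
  by rewrite is_norm0.
rewrite mulrC -ler_pdivlMr//; apply: ge_sup.
  by exists (dual_norm N (x - x)), x.
move=> _ [v Xv <-]; apply: ge_sup; first exact: (has_sup_dual_norm hN _).1.
by move=> _ [u /= Nu <-]; rewrite dotC ler_pdivlMr// mulrC; exact: ra.
Qed.

(** This and [regret_le] characterise the regret as the supremum of
    dot w (x - v) over v in X; nothing below returns to the infimum defining
    it. *)
Lemma dot_le_regret x v w : X v -> dot w (x - v) <= regret X x w.
Proof.
move=> Xv; rewrite /regret dotBr lerD2l lerN2; apply: ge_inf; last by exists v.
have [K K0 NK] := normr_dot_le_is_norm hN.
have [M [_ /(_ (M + 1))]] := compact_bounded X_compact.
rewrite ltrDl ltr01 => /(_ isT) XM.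
exists (- (K * N w * (M + 1))) => _ [y Xy <-].
have : `|dot w y| <= K * N w * (M + 1).
  rewrite (le_trans (NK _ _))// ler_wpM2l ?mulr_ge0 ?is_norm_ge0//.
  exact: XM.
by rewrite ler_norml => /andP[].
Qed.

Lemma regret_le x w a : X !=set0 ->
  (forall v, X v -> dot w (x - v) <= a) -> regret X x w <= a.
Proof.
move=> [v0 Xv0] xa; rewrite /regret lerBlDl -lerBlDr; apply: lb_le_inf.
  by exists (dot w v0), v0.
by move=> _ [v Xv <-]; have := xa v Xv; rewrite dotBr; lra.
Qed.

Lemma regret_ge0 x w : X x -> 0 <= regret X x w.
Proof.
by move=> /dot_le_regret -/(_ x w); rewrite subrr /dot trmx0 mulmx0 mxE.
Qed.

(** Each linear piece dot w (x - v) of the regret is Lipschitz with constant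
    [D x], hence so is their supremum. *)
Lemma regret_lipschitz x w w' : X x ->
  regret X x w <= regret X x w' + D x * N (w - w').
Proof.
move=> Xx; apply: regret_le; first by exists x.
move=> v Xv; rewrite -(subrK w' w) dotDl addrC subrK.
by apply: lerD; [exact: dot_le_regret|exact: dot_le_max_dual_dist].
Qed.

Lemma regret_le_norm x w : X x -> regret X x w <= D x * N w.
Proof.
move=> Xx; apply: regret_le; first by exists x.
by move=> v; exact: dot_le_max_dual_dist.
Qed.

Lemma regret_continuous x : X x -> continuous (regret X x).
Proof.
move=> Xx; apply: (lipschitz_is_continuous hN (max_dual_dist_ge0 Xx)) => w w'.
exact: regret_lipschitz.
Qed.

(** Translating the outcome by s u raises the regret at the full rate
    dot u (x - v) in s, up to an error that does not depend on s. *)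
Lemma regret_shift_ge x v u w s : X v ->
  s * dot u (x - v) <= regret X x (w + s *: u) + D x * N w.
Proof.
move=> Xv; have := dot_le_regret x (w + s *: u) Xv.
have := dot_le_max_dual_dist x (- w) Xv.
by rewrite is_normN// -scaleN1r !(dotDl, dotZl); lra.
Qed.

(** The subtracted infimum does not depend on the decision. *)
Lemma regretB x y w : regret X x w + dot w y = regret X y w + dot w x.
Proof. by rewrite /regret; ring. Qed.

End regret.

(** * Borel measurability, image measures and mixtures *)

Section borel.
Context (R : realType).
Implicit Types T U : ptopologicalType.

Lemma continuous_borel_measurable T U (f : T -> U) : continuous f ->
  measurable_fun [set: borel T] (f : borel T -> borel U).
Proof.
move=> /continuousP cf.
apply: (@measurability _ _ (borel T) (borel U) _ _ open) => //.
move=> _ [A oA <-]; rewrite setTI; apply: sub_sigma_algebra; exact: cf.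
Qed.

Lemma continuous_measurable_real T (f : T -> R) : continuous f ->
  measurable_fun [set: borel T] (f : borel T -> R).
Proof.
move=> /continuousP cf; apply: (measurability _ (RGenOpens.measurableE R)).
move=> _ [_ [a [b ->] <-]]; rewrite setTI; apply: sub_sigma_algebra.
exact/cf/interval_open.
Qed.

Lemma continuous_borel_measurable_EFin T (f : T -> R) : continuous f ->
  measurable_fun [set: borel T] (fun x : borel T => (f x)%:E).
Proof.
by move=> cf; apply/measurable_EFinP; exact: continuous_measurable_real.
Qed.

End borel.

Section mixture.
Context d d' (T : measurableType d) (U : measurableType d') (R : realType).
Implicit Types (P : probability T R) (f g : T -> U) (a b : R).

(** The law of a random element equal to f with probability a and to g with
    probability b. Both the perturbed distribution of the lower bound and its
    coupling with the nominal one arise in this way. *)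
Lemma mixture_exists P f g a b :
    (0 <= a)%R -> (0 <= b)%R -> (a + b = 1)%R ->
    measurable_fun setT f -> measurable_fun setT g ->
  exists Q : probability U R,
    (forall A, Q A = a%:E * P (f @^-1` A) + b%:E * P (g @^-1` A)) /\
    (forall h : U -> \bar R, measurable_fun setT h -> (forall y, 0 <= h y) ->
      \int[Q]_y h y = a%:E * \int[P]_x h (f x) + b%:E * \int[P]_x h (g x)).
Proof.
move=> a0 b0 ab mf mg.
pose F : {mfun T >-> U} := HB.pack f (isMeasurableFun.Build _ _ _ _ _ mf).
pose G : {mfun T >-> U} := HB.pack g (isMeasurableFun.Build _ _ _ _ _ mg).
pose Q : {measure set U -> \bar R} :=
  measure_add (mscale (NngNum a0) (distribution P F))
              (mscale (NngNum b0) (distribution P G)).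
have QE A : Q A = a%:E * P (f @^-1` A) + b%:E * P (g @^-1` A).
  exact: measure_addE.
have Q1 : Q setT = 1%:E.
  by rewrite QE !preimage_setT probability_setT !mule1 -EFinD ab.
pose QQ : probability U R :=
  HB.pack (Measure.sort Q) (Measure_isProbability.Build _ _ _ Q Q1).
exists QQ; split => // h mh h0.
rewrite [LHS]ge0_integral_measure_add// !ge0_integral_mscale//.
by rewrite !ge0_integral_distribution.
Qed.

End mixture.

(** Change of variables when the image measure is known only on measurable
    sets, as for the marginals of a coupling. *)
Lemma ge0_integral_image d d' (T : measurableType d) (U : measurableType d')
    (R : realType) (mu : {measure set T -> \bar R})
    (nu : {measure set U -> \bar R}) (f : T -> U) (h : U -> \bar R) :
    measurable_fun setT f ->
    (forall A, measurable A -> mu (f @^-1` A) = nu A) ->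
    measurable_fun setT h -> (forall y, 0 <= h y) ->
  \int[nu]_y h y = \int[mu]_x h (f x).
Proof.
move=> mf munu mh h0.
rewrite -[RHS](@ge0_integral_pushforward _ _ _ _ _ _ mf _ setT h)//.
by apply: eq_measure_integral => A mA _; rewrite -munu.
Qed.

(** * Integrability and continuity on the space of outcomes *)

Section outcome_space.
Context (R : realType) (n : nat) (N : 'rV[R]_n -> R) (X : set 'rV[R]_n).
Context (hN : is_norm N) (X_compact : compact X).
Implicit Types (P : probability (borel 'rV[R]_n) R) (x u v w : 'rV[R]_n).
Local Notation V := ('rV[R]_n).
Local Notation D := (max_dual_dist N X).

Lemma integrable_affine_growth P (f : V -> R) a b :
    (0 <= a)%R -> (0 <= b)%R -> finite_moment N P -> continuous f ->
    (forall w, `|f w| <= a * N w + b)%R ->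
  P.-integrable [set: borel V] (EFin \o f).
Proof.
rewrite /finite_moment unlock => a0 b0 PN cf fab.
have mf := continuous_borel_measurable_EFin cf.
have mN := continuous_borel_measurable_EFin (is_norm_continuous hN).
have N0 w : 0 <= (N w)%:E by rewrite lee_fin is_norm_ge0.
apply/integrableP; split=> //.
apply: (@le_lt_trans _ _ (\int[P]_w (a%:E * (N w)%:E + b%:E))).
  apply: ge0_le_integral => //.
  - by apply: measurableT_comp => //; exact: measurable_normr.
  - by apply: emeasurable_funD => //; exact: measurable_funeM.
  - by move=> w _; rewrite lee_fin.
rewrite ge0_integralD//; [|by move=> w _; rewrite mule_ge0|
  exact: measurable_funeM].
have := expectation_cst P b; rewrite unlock /= => ->.
by rewrite ge0_integralZl_EFin// lte_add_pinfty ?ltry// lte_mul_pinfty.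
Qed.

Lemma integrable_regret P x : finite_moment N P -> X x ->
  P.-integrable [set: borel V] (EFin \o regret X x).
Proof.
move=> PN Xx; apply: (@integrable_affine_growth _ _ (D x) 0%R) => //.
- exact: (max_dual_dist_ge0 hN).
- exact: (regret_continuous hN).
- by move=> w; rewrite addr0 ger0_norm ?(regret_ge0 hN)// (regret_le_norm hN).
Qed.

Lemma integrable_dot P y : finite_moment N P ->
  P.-integrable [set: borel V] (EFin \o (fun w => dot w y)).
Proof.
move=> PN; have [K K0 NK] := normr_dot_le_is_norm hN.
have Ky0 : (0 <= K * `|y|)%R by rewrite mulr_ge0.
apply: (@integrable_affine_growth _ _ (K * `|y|)%R 0%R) => //.
- apply: (lipschitz_is_continuous hN Ky0) => w w'.
  rewrite -lerBlDl -dotBl (le_trans (ler_norm _))// (le_trans (NK _ _))//.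
  by rewrite mulrAC.
- by move=> w; rewrite addr0 mulrAC.
Qed.

Lemma continuous_sub_pair : continuous (fun z : V * V => (z.1 - z.2)%R).
Proof.
by move=> z; exact: (@cvgB _ _ _ (nbhs z) _ fst snd z.1 z.2 cvg_fst cvg_snd).
Qed.

Lemma continuous_norm_sub_pair :
  continuous (fun z : V * V => N (z.1 - z.2)%R).
Proof.
move=> z; apply: (continuous_comp (continuous_sub_pair (x:=z))).
exact: is_norm_continuous.
Qed.

Lemma continuous_pair_norm : continuous (pair_norm N : V * V -> R).
Proof.
have cN := is_norm_continuous hN.
move=> z; apply: (@cvgD _ _ _ (nbhs z) _ (N \o fst) (N \o snd)).
  by apply: continuous_comp; [exact: cvg_fst|exact: cN].
by apply: continuous_comp; [exact: cvg_snd|exact: cN].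
Qed.

Lemma measurable_borel_fst :
  measurable_fun setT (fst : borel (V * V)%type -> borel V).
Proof. by apply: continuous_borel_measurable => z; exact: cvg_fst. Qed.

Lemma measurable_borel_snd :
  measurable_fun setT (snd : borel (V * V)%type -> borel V).
Proof. by apply: continuous_borel_measurable => z; exact: cvg_snd. Qed.

Lemma coupling_finite_moment P P0 pi : coupling N P P0 pi -> finite_moment N P.
Proof.
move=> [piN pi1 _]; move: piN; rewrite /finite_moment unlock => piN.
have mN := continuous_borel_measurable_EFin (is_norm_continuous hN).
have mNp := continuous_borel_measurable_EFin continuous_pair_norm.
have N0 w : 0 <= (N w)%:E by rewrite lee_fin is_norm_ge0.
rewrite (ge0_integral_image measurable_borel_fst pi1 mN N0).
apply: le_lt_trans piN; apply: ge0_le_integral => //.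
  exact: measurableT_comp mN measurable_borel_fst.
by move=> z _; rewrite lee_fin lerDl is_norm_ge0.
Qed.

Lemma continuous_shift u : continuous (fun w : V => (w + u)%R).
Proof.
move=> w; apply: (@cvgD _ _ _ (nbhs w) _ id (fun=> u) w u).
  exact: cvg_id.
exact: cvg_cst.
Qed.

Lemma continuous_shift_pair u : continuous (fun w : V => ((w + u)%R, w)).
Proof.
move=> w.
apply: (@cvg_pair _ _ _ (nbhs w) (nbhs (w + u)%R) (nbhs w)).
  exact: continuous_shift.
exact: cvg_id.
Qed.

End outcome_space.

(** * Expected regret over the Wasserstein ball *)

Section expected_regret.
Context (R : realType) (n : nat) (N : 'rV[R]_n -> R) (X : set 'rV[R]_n).
Context (hN : is_norm N) (X_compact : compact X).
Implicit Types (P : probability (borel 'rV[R]_n) R) (x u v w : 'rV[R]_n).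
Local Notation V := ('rV[R]_n).
Local Notation D := (max_dual_dist N X).

Lemma integral_shift_lty P u : finite_moment N P ->
  \int[P]_w (N (w + u)%R + N w)%:E < +oo.
Proof.
move=> PN.
have N0 w : (0 <= N (w + u)%R + N w)%R.
  by apply: addr_ge0; exact: is_norm_ge0.
have cN : continuous (fun w : V => N (w + u)%R + N w)%R.
  apply: (@lipschitz_is_continuous _ _ _ hN _ 2%R) => // w w'.
  have := is_normD hN (w' + u)%R (w - w')%R.
  have := is_normD hN w' (w - w')%R.
  by rewrite addrAC ![(w' + (w - w'))%R]addrC subrK; lra.
have : P.-integrable setT (EFin \o (fun w => N (w + u)%R + N w)%R).
  apply: (@integrable_affine_growth _ _ _ hN _ _ 2%R (N u)) => //.
    exact: is_norm_ge0.
  by move=> w; have := is_normD hN w u; rewrite ger0_norm//; lra.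
move=> /integrableP[_]; congr (_ < _); apply: eq_integral => w _ /=.
by rewrite ger0_norm.
Qed.

Lemma expectation_regret_ge0 P x : X x -> 0 <= 'E_P[regret X x].
Proof. by move=> Xx; apply: expectation_ge0 => w; exact: (regret_ge0 hN). Qed.

Lemma expectation_regret_fin_num P x : finite_moment N P -> X x ->
  'E_P[regret X x] \is a fin_num.
Proof.
move=> PN Xx; rewrite unlock integrable_fin_num//.
exact: (integrable_regret hN).
Qed.

Lemma expectation_regret_le_coupling P P0 pi x : X x -> coupling N P P0 pi ->
  'E_P[regret X x] <=
  'E_P0[regret X x] + (D x)%:E * \int[pi]_z (N (z.1 - z.2)%R)%:E.
Proof.
move=> Xx [_ pi1 pi2]; rewrite unlock.
have mR := continuous_borel_measurable_EFin (regret_continuous hN X_compact Xx).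
have R0 w : 0 <= (regret X x w)%:E by rewrite lee_fin (regret_ge0 hN).
have mN := continuous_borel_measurable_EFin (continuous_norm_sub_pair hN).
have N0 (z : V * V) : 0 <= (N (z.1 - z.2)%R)%:E.
  by rewrite lee_fin (is_norm_ge0 hN).
have D0 := max_dual_dist_ge0 hN X_compact Xx.
have m1 := @measurable_borel_fst R n.
have m2 := @measurable_borel_snd R n.
rewrite (ge0_integral_image m1 pi1 mR R0) (ge0_integral_image m2 pi2 mR R0).
rewrite -ge0_integralZl_EFin// -ge0_integralD//.
- apply: ge0_le_integral => //.
  + exact: measurableT_comp mR m1.
  + apply: emeasurable_funD; first exact: measurableT_comp mR m2.
    exact: measurable_funeM.
  + by move=> z _; rewrite lee_fin; exact: (regret_lipschitz hN).
- exact: measurableT_comp mR m2.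
- by move=> z _; rewrite mule_ge0.
- exact: measurable_funeM.
Qed.

(** The coupling is chosen within [d] of the infimum; [d] is scaled so that the
    Lipschitz constant turns it into an error of at most [e]. *)
Lemma expectation_regret_le P P0 r x : X x -> wasserstein_ball N P0 r P ->
  'E_P[regret X x] <= 'E_P0[regret X x] + (r * D x)%:E.
Proof.
move=> Xx [PN W1r]; apply/lee_addgt0Pr => e e0.
have D0 := max_dual_dist_ge0 hN X_compact Xx.
pose d := (e / (D x + 1))%R.
have d0 : (0 < d)%R by rewrite divr_gt0// ltr_wpDl.
have : W1 N P P0 < (r + d)%:E.
  by apply: le_lt_trans W1r _; rewrite lte_fin ltrDl.
move=> /ereal_inf_lt[_ [pi cpi <-] pird].
apply: le_trans (expectation_regret_le_coupling Xx cpi) _.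
rewrite -addeA leeD2l// -EFinD.
apply: le_trans (lee_wpmul2l _ (ltW pird)) _; first by rewrite lee_fin.
rewrite -EFinM lee_fin mulrDr mulrC lerD2l /d mulrCA ger_pMr//.
by rewrite ler_pdivrMr ?mul1r ?lerDl// ltr_wpDl.
Qed.

(** The perturbed distribution: mass [e] is translated by (r/e) u. It is
    coupled with P0 by remembering the outcome before the translation, which
    costs e N((r/e) u) <= r. *)
Lemma shift_mixture_in_ball P0 u e r : finite_moment N P0 ->
    (0 < e)%R -> (e <= 1)%R -> (0 <= r)%R -> (N u <= 1)%R ->
  exists2 P, wasserstein_ball N P0 r P &
    forall h : V -> \bar R, measurable_fun [set: borel V] h ->
      (forall w, 0 <= h w) ->
      \int[P]_w h w = (1 - e)%:E * \int[P0]_w h w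
                      + e%:E * \int[P0]_w h (w + (r / e) *: u)%R.
Proof.
move=> P0N e0 e1 r0 Nu; set s := ((r / e) *: u)%R.
have e'0 : (0 <= 1 - e)%R by rewrite subr_ge0.
have ee : (1 - e + e = 1)%R by rewrite subrK.
have m1 t := continuous_borel_measurable (@continuous_shift R n t).
have m2 t := continuous_borel_measurable (@continuous_shift_pair R n t).
(* The mass that stays is written as a translation by 0, so that both parts
   of the mixture have the same form. *)
have [P [PE Pint]] := mixture_exists P0 e'0 (ltW e0) ee (m1 0%R) (m1 s).
have [pi [piE piint]] := mixture_exists P0 e'0 (ltW e0) ee (m2 0%R) (m2 s).
have mNp := continuous_borel_measurable_EFin (continuous_pair_norm hN).
have Np0 z : 0 <= (pair_norm N z)%:E.
  by rewrite lee_fin addr_ge0// is_norm_ge0.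
have mNB := continuous_borel_measurable_EFin (continuous_norm_sub_pair hN).
have NB0 (z : V * V) : 0 <= (N (z.1 - z.2)%R)%:E.
  by rewrite lee_fin is_norm_ge0.
have cpi : coupling N P P0 pi.
  split => [|A mA|A mA].
  - rewrite /finite_moment unlock piint//.
    have lty t := @integral_shift_lty P0 t P0N.
    apply: lte_add_pinfty; apply: lte_mul_pinfty => //; try exact: lty.
    by rewrite lee_fin ltW.
  - by rewrite piE PE.
  - rewrite piE; transitivity ((1 - e)%:E * P0 A + e%:E * P0 A) => //.
    by rewrite -ge0_muleDl ?lee_fin ?(ltW e0)// -EFinD ee mul1e.
exists P.
  split; first exact: (coupling_finite_moment hN cpi).
  apply: ge_ereal_inf; exists (\int[pi]_z (N (z.1 - z.2)%R)%:E).
    by exists pi.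
  rewrite piint//=.
  have diff t : \int[P0]_w (N (w + t - w)%R)%:E = (N t)%:E.
    rewrite -(expectation_cst P0) unlock; apply: eq_integral => w _ /=.
    by rewrite addrAC subrr add0r.
  rewrite !diff is_norm0// mule0 add0e -EFinM lee_fin (is_normZ hN).
  rewrite ger0_norm ?divr_ge0 ?(ltW e0)// mulrA.
  rewrite [(e * _)%R]mulrC divfK ?gt_eqF//.
  by rewrite ler_piMr.
move=> h mh h0; rewrite Pint//; congr (_ * _ + _).
by apply: eq_integral => w _; rewrite addr0.
Qed.

(** The expected regret of the perturbed distribution is (1 - e) times the
    nominal one plus the contribution of the translated mass, bounded below by
    [regret_shift_ge]. The term e E[R] on the right restores the full nominal
    regret, and e L E[N] absorbs the error of [regret_shift_ge]; together they
    are e times a constant. *)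
Lemma expectation_regret_ge P0 u v e r x : finite_moment N P0 ->
    (0 < e)%R -> (e <= 1)%R -> (0 <= r)%R -> (N u <= 1)%R -> X x -> X v ->
  exists2 P, wasserstein_ball N P0 r P &
    'E_P0[regret X x] + (r * dot u (x - v))%:E <=
    'E_P[regret X x] + e%:E * ('E_P0[regret X x] + (D x)%:E * 'E_P0[N]).
Proof.
move=> P0N e0 e1 r0 Nu Xx Xv.
have [P Pr Pint] := shift_mixture_in_ball P0N e0 e1 r0 Nu.
exists P => //.
have mR := continuous_borel_measurable_EFin (regret_continuous hN X_compact Xx).
have R0 w : 0 <= (regret X x w)%:E by rewrite lee_fin (regret_ge0 hN).
have mN := continuous_borel_measurable_EFin (is_norm_continuous hN).
have N0 w : 0 <= (N w)%:E by rewrite lee_fin (is_norm_ge0 hN).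
have D0 := max_dual_dist_ge0 hN X_compact Xx.
rewrite unlock Pint// [e%:E * (_ + _)]ge0_muleDr ?mule_ge0 ?integral_ge0//.
have cS : continuous (fun w : V => regret X x (w + (r / e) *: u)%R).
  move=> w; pose u' := ((r / e) *: u)%R.
  apply: (continuous_comp (continuous_shift (u := u') (x := w))).
  exact: (regret_continuous hN).
have mS := continuous_borel_measurable_EFin cS.
have S0 w : 0 <= (regret X x (w + (r / e) *: u)%R)%:E by exact: R0.
have rE : (r = e * (r / e))%R by rewrite mulrC divfK ?gt_eqF.
(* [regret_shift_ge] with s = r / e, integrated and multiplied by e. A
   negative left-hand side is treated apart, to stay among nonnegative
   integrands. *)
have gain : (r * dot u (x - v))%:E <=
    e%:E * \int[P0]_w (regret X x (w + (r / e) *: u)%R)%:E +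
    e%:E * ((D x)%:E * \int[P0]_w (N w)%:E).
  rewrite -ge0_muleDr ?mule_ge0 ?integral_ge0//.
  rewrite -[X in _ + X]ge0_integralZl_EFin// -ge0_integralD//; last 2 first.
  - by move=> w _; rewrite mule_ge0.
  - exact: measurable_funeM.
  rewrite {1}rE -mulrA EFinM lee_wpmul2l ?lee_fin ?(ltW e0)//.
  have [le0|/ltW ge0] := lerP ((r / e) * dot u (x - v)) 0.
    apply: le_trans (_ : 0%E <= _); first by rewrite lee_fin.
    by apply: integral_ge0 => w _; rewrite adde_ge0 ?mule_ge0.
  rewrite -[leLHS](expectation_cst P0) unlock; apply: ge0_le_integral => //.
  - apply: (continuous_borel_measurable_EFin (f := cst _)).
    exact: cst_continuous.
  - by apply: emeasurable_funD => //; exact: measurable_funeM.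
  - by move=> w _; rewrite lee_fin; exact: (regret_shift_ge hN).
rewrite addeACA; apply: leeD gain.
by rewrite -ge0_muleDl ?lee_fin ?subr_ge0 ?(ltW e0)// -EFinD subrK mul1e.
Qed.

(** For fixed u and v the lower bound follows from [expectation_regret_ge] as e
    tends to 0, because the error is e times the finite number M below. *)
Lemma worst_case_regretE P0 r x : finite_moment N P0 -> (0 <= r)%R -> X x ->
  worst_case_regret N P0 r X x = 'E_P0[regret X x] + (r * D x)%:E.
Proof.
move=> P0N r0 Xx; apply/eqP; rewrite eq_le; apply/andP; split.
  by apply: ge_ereal_sup => _ [P Pr <-]; exact: expectation_regret_le.
have D0 := max_dual_dist_ge0 hN X_compact Xx.
have ER_fin := expectation_regret_fin_num P0N Xx.
have [M M0 EM] : exists2 M : R, (0 <= M)%R &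
    'E_P0[regret X x] + (D x)%:E * 'E_P0[N] = M%:E.
  have M0 : 0 <= 'E_P0[regret X x] + (D x)%:E * 'E_P0[N].
    rewrite adde_ge0 ?expectation_regret_ge0// mule_ge0// expectation_ge0//.
    by move=> w; exact: is_norm_ge0.
  exists (fine ('E_P0[regret X x] + (D x)%:E * 'E_P0[N])).
    exact: fine_ge0.
  rewrite fineK// ge0_fin_numE// lte_add_pinfty//.
    by rewrite -ge0_fin_numE// expectation_regret_ge0.
  by rewrite lte_mul_pinfty.
have lower u v : (N u <= 1)%R -> X v ->
    'E_P0[regret X x] + (r * dot u (x - v))%:E <= worst_case_regret N P0 r X x.
  move=> Nu Xv; apply/lee_addgt0Pr => d d0.
  (* e <= 1 to be a probability, and e M <= d to make the error small. *)
  pose e := Num.min 1%R (d / (M + 1))%R.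
  have M1 : (0 < M + 1)%R by rewrite ltr_wpDl.
  have e0 : (0 < e)%R by rewrite lt_min ltr01 divr_gt0.
  have e1 : (e <= 1)%R by rewrite ge_min lexx.
  have [P Pr] := expectation_regret_ge P0N e0 e1 r0 Nu Xx Xv.
  move=> /le_trans; apply; rewrite EM; apply: leeD.
    by apply: ereal_sup_ubound; exists P.
  rewrite -EFinM lee_fin (@le_trans _ _ (d / (M + 1) * M))%R//.
    by rewrite ler_wpM2r// ge_min lexx orbT.
  by rewrite mulrAC ler_pdivrMr// ler_wpM2l ?lerDl// ltW.
move: lower; rewrite -(fineK ER_fin).
case: (worst_case_regret _ _ _ _ _) => [c| |] lower; last 2 first.
- exact: leey.
- have /lower : (N 0%R <= 1)%R by rewrite is_norm0.
  by move=> /(_ _ Xx); rewrite -EFinD leeNy_eq.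
rewrite -EFinD lee_fin -lerBrDl.
apply: (mul_max_dual_dist_le hN) => // u v Nu Xv.
by rewrite lerBrDl -lee_fin EFinD lower.
Qed.

(** [regretB] in expectation, stated with sums so that no infinity is ever
    subtracted. *)
Lemma expectation_regretB P x y : finite_moment N P -> X x -> X y ->
  'E_P[regret X x] + 'E_P[fun w => dot w y] =
  'E_P[regret X y] + 'E_P[fun w => dot w x].
Proof.
move=> PN Xx Xy; rewrite unlock.
rewrite -!integralD_EFin//; try exact: (integrable_regret hN);
  try exact: (integrable_dot hN).
by apply: eq_integral => w _; rewrite /= -!EFinD regretB.
Qed.

End expected_regret.
Theorem theorem2 (R : realType) (n : nat) (N : 'rV[R]_n -> R)
    (P0 : probability (borel 'rV[R]_n) R) (r : R) (X : set 'rV[R]_n)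
    (N_norm : is_norm N) (P0_moment : finite_moment N P0) (r_ge0 : (0 <= r)%R)
    (X_neq0 : X !=set0) (X_compact : compact X) :
  (forall x, X x ->
     worst_case_regret N P0 r X x
     = 'E_P0[regret X x] + (r * max_dual_dist N X x)%:E) /\
  (forall x, X x ->
     optimal_solution X (worst_case_regret N P0 r X) x <->
     optimal_solution X
       (fun y => 'E_P0[fun w => dot w y] + (r * max_dual_dist N X y)%:E) x).
Proof.
have wcE := worst_case_regretE N_norm X_compact P0_moment r_ge0.
split=> // x Xx.
have dot_fin y : 'E_P0[fun w => dot w y] \is a fin_num.
  rewrite unlock integrable_fin_num//; exact: (integrable_dot N_norm).
have same_order y : X y ->
    (worst_case_regret N P0 r X x <= worst_case_regret N P0 r X y) =
    ('E_P0[fun w => dot w x] + (r * max_dual_dist N X x)%:E <=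
     'E_P0[fun w => dot w y] + (r * max_dual_dist N X y)%:E).
  move=> Xy; rewrite !wcE//.
  have := expectation_regretB N_norm X_compact P0_moment Xx Xy.
  rewrite -(fineK (dot_fin x)) -(fineK (dot_fin y)).
  rewrite -(fineK (expectation_regret_fin_num N_norm X_compact P0_moment Xx)).
  rewrite -(fineK (expectation_regret_fin_num N_norm X_compact P0_moment Xy)).
  rewrite -!EFinD !lee_fin => -[eq_xy].
  by apply/idP/idP; lra.
by split=> -[_ opt]; split=> // y Xy; have := opt y Xy; rewrite same_order.
Qed.
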